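(* Let $G$ be an Abelian group and let $\phi,\psi:G\to G$ be two endomorphisms of $G$. If at least one of the numbers $R(\phi,\psi)$ and $\#\operatorname{Coin}(\widehat\phi,\widehat\psi)$ is finite, then $$R(\phi,\psi)=\#\operatorname{Coin}(\widehat\phi,\widehat\psi).$$
   Context: $G$ is regarded as a discrete group. Two elements $x,x'\in G$ are called $(\phi,\psi)$-conjugate if there exists $\gamma\in G$ with $x'=\psi(\gamma)\,x\,\phi(\gamma)^{-1}$; this is an equivalence relation, and the Reidemeister coincidence number $R(\phi,\psi)\in\{1,2,\dots\}\cup\{\infty\}$ is the number of $(\phi,\psi)$-conjugacy classes in $G$. The unitary dual $\widehat G$ is the set of equivalence classes of unitary irreducible representations of $G$; since $G$ is Abelian these are the one-dimensional unitary characters $\rho:G\to\{z\in\mathbb C:|z|=1\}$. An endomorphism $\phi$ of $G$ induces the map $\widehat\phi:\widehat G\to\widehat G$, $\widehat\phi(\rho)=\rho\circ\phi$. The set of coincidence points is $\operatorname{Coin}(\widehat\phi,\widehat\psi)=\{\rho\in\widehat G:\widehat\phi(\rho)=\widehat\psi(\rho)\}$. *)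

(* Defs.v *)
From HB Require Import structures.
From mathcomp Require Import all_boot all_order all_algebra.
From mathcomp Require Import complex.
From mathcomp Require Import boolp classical_sets cardinality reals ereal.
From mathcomp Require Import measure.
Set Implicit Arguments.
Unset Strict Implicit.
Unset Printing Implicit Defensive.
Import Order.TTheory GRing.Theory Num.Theory.
Local Open Scope classical_set_scope.
Local Open Scope ring_scope.

(* Abelian groups are written additively (zmodType), so psi(g) x phi(g)^-1
   becomes psi g + x - phi g. *)
Definition twisted_conj (G : zmodType) (phi psi : {additive G -> G})
    (x x' : G) : Prop :=
  exists g : G, x' = psi g + x - phi g.

Definition twisted_class (G : zmodType) (phi psi : {additive G -> G})
    (x : G) : set G :=
  [set x' | twisted_conj phi psi x x'].

Definition twisted_classes (G : zmodType) (phi psi : {additive G -> G}) :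
    set (set G) :=
  range (twisted_class phi psi).

Lemma twisted_conj_refl (G : zmodType) (phi psi : {additive G -> G}) (x : G) :
  twisted_conj phi psi x x.
Proof. by exists 0; rewrite !raddf0 add0r addr0. Qed.

Lemma twisted_conj_sym (G : zmodType) (phi psi : {additive G -> G})
    (x y : G) :
  twisted_conj phi psi x y -> twisted_conj phi psi y x.
Proof.
move=> [g ->]; exists (- g).
by rewrite !raddfN opprK -addrA [_ + phi g]subrK addKr.
Qed.

Lemma twisted_conj_trans (G : zmodType) (phi psi : {additive G -> G})
    (x y z : G) :
  twisted_conj phi psi x y -> twisted_conj phi psi y z ->
  twisted_conj phi psi x z.
Proof.
move=> [g ->] [h ->]; exists (h + g).
rewrite (raddfD psi) (raddfD phi) opprD !addrA.
exact: addrAC.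
Qed.

(* [counting A : \bar R] is the number of elements of A when A is finite, and
   +oo otherwise. *)
Definition reidemeister_number (R : realType) (G : zmodType)
    (phi psi : {additive G -> G}) : \bar R :=
  counting (twisted_classes phi psi).

(* G carries the discrete topology, so no continuity is required; G being
   Abelian, its irreducible unitary representations, up to equivalence, are its
   unitary characters. *)
Definition unitary_dual (R : realType) (G : zmodType) : set (G -> R[i]) :=
  [set rho | (forall x y : G, rho (x + y) = rho x * rho y) /\
             (forall x : G, `|rho x| = 1)].
Arguments unitary_dual : clear implicits.

Definition dual_map (R : realType) (G : zmodType) (phi : {additive G -> G})
    (rho : G -> R[i]) : G -> R[i] :=
  rho \o phi.

Lemma dual_map_unitary_dual (R : realType) (G : zmodType)
    (phi : {additive G -> G}) (rho : G -> R[i]) :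
  unitary_dual R G rho -> unitary_dual R G (dual_map phi rho).
Proof.
move=> [rhoD rho1]; split => [x y|x]; last exact: rho1.
by rewrite /dual_map /= raddfD rhoD.
Qed.

Definition coincidence_points (R : realType) (G : zmodType)
    (phi psi : {additive G -> G}) : set (G -> R[i]) :=
  [set rho | unitary_dual R G rho /\ dual_map phi rho = dual_map psi rho].
Arguments coincidence_points R {G} phi psi.

Definition coincidence_number (R : realType) (G : zmodType)
    (phi psi : {additive G -> G}) : \bar R :=
  counting (coincidence_points R phi psi).

(* Main.v *)
Require Import Defs.
From HB Require Import structures.
From mathcomp Require Import all_boot all_order all_algebra.
From mathcomp Require Import complex.
From mathcomp Require Import boolp classical_sets cardinality reals ereal.
From mathcomp Require Import measure.
From mathcomp Require Import functions fsbigop finmap.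
Set Implicit Arguments.
Unset Strict Implicit.
Unset Printing Implicit Defensive.
Import Order.TTheory GRing.Theory Num.Theory.
Local Open Scope classical_set_scope.
Local Open Scope ring_scope.

(** The twisted conjugacy class of x is the coset x + H of the subgroup
    H = {psi g - phi g}, and a character rho satisfies rho \o phi = rho \o psi
    exactly when it is trivial on H. The theorem thus says that the group
    G / H and its dual, the annihilator of H, are finite together and then have
    the same number of elements.

    The proof treats the two sides symmetrically. Consider a pairing e of two
    nonempty sets P and Q with nonzero values in an algebraically closed field of
    characteristic 0, such that multiplying by e i amounts to a permutation of
    P and multiplying by e ^~ j amounts to a permutation of Q, and such that
    each side separates the points of the other. Then P and Q are equinumerous
    or both infinite ([counting_perfect_pairing]):
    - if Q has N elements, then multiplying all e i j' over j' in Q, and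
      permuting Q by the translation attached to j, gives e i j ^+ N = 1; so
      the elements of P are functions from a finite set to the finite set of
      N-th roots of unity, and P is finite ([finite_translation_closed]);
    - if both are finite, the double sum of e i j over P and Q equals the
      cardinal of Q, because the inner sum over Q vanishes unless e i = 1
      ([fsum_pairing]); exchanging the sums gives the cardinal of P.

    The one hypothesis with content for the evaluation pairing between
    coincidence points and twisted classes is that characters of G trivial on
    H separate the points of G / H. This is the divisibility of the unit
    circle combined with the lemma of Zorn ([separating_character]). *)

(** * Pairings of sets that are closed under translation *)

(** A group structure on P that e turns into multiplication, seen through its
    translations alone: h is the translation by i. In this form a bare set of
    cosets qualifies without a quotient group being formed. *)
Definition translation_closed (F : fieldType) (I J : choiceType)
    (P : set I) (Q : set J) (e : I -> J -> F) : Prop :=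
  forall i, P i -> exists2 h : I -> I, set_bij P P h &
    forall i' j, P i' -> Q j -> e (h i') j = e i j * e i' j.

Definition separated (F : fieldType) (I J : choiceType)
    (P : set I) (Q : set J) (e : I -> J -> F) : Prop :=
  forall i i', P i -> P i' -> (forall j, Q j -> e i j = e i' j) -> i = i'.

(** The product of the values of f over P is nonzero and unchanged by the
    permutation h, which multiplies it by c once for each element of P. *)
Lemma expr_card_eigenbij (F : fieldType) (I : choiceType) (P : set I)
    (f : I -> F) (c : F) (h : I -> I) :
  finite_set P -> set_bij P P h -> (forall i, P i -> f i != 0) ->
  (forall i, P i -> f (h i) = c * f i) -> c ^+ #|` fset_set P| = 1.
Proof.
move=> finP bijh f0 fh.
pose p := \big[*%R/1]_(i \in P) f i.
have p0 : p != 0.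
  rewrite /p fsbig_finite// prodf_seq_neq0; apply/allP => i.
  by rewrite in_fset_set// => /set_mem; apply: f0.
have pE : p = c ^+ #|` fset_set P| * p.
  rewrite {1}/p (reindex_fsbig h P P)//.
  rewrite (eq_fsbigr (fun i => c * f i)); last by move=> i /set_mem /fh.
  rewrite fsbig_split//; congr (_ * _).
  by rewrite fsbig_finite// big_const_seq count_predT iter_mulr_1.
by apply: (mulIf p0); rewrite -pE mul1r.
Qed.

(** Orthogonality in its bare form: reindexing by h shows that the sum is fixed
    by multiplication by c. *)
Lemma fsum_eigenbij0 (F : fieldType) (I : choiceType) (P : set I)
    (f : I -> F) (c : F) (h : I -> I) :
  set_bij P P h -> c != 1 ->
  (forall i, P i -> f (h i) = c * f i) -> \sum_(i \in P) f i = 0.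
Proof.
move=> bijh c1 fh; apply/eqP.
have /eqP : \sum_(i \in P) f i = c * \sum_(i \in P) f i.
  rewrite {1}(reindex_fsbig h P P)// mulr_fsumr.
  by apply: eq_fsbigr => i /set_mem /fh.
rewrite -subr_eq0 -[X in X - _]mul1r -mulrBl mulf_eq0 subr_eq0 eq_sym.
by rewrite (negbTE c1).
Qed.

(** There are only finitely many functions from a finite set to the finite set
    of N-th roots of unity. *)
Lemma finite_family_roots_of_unity (F : closedFieldType) (I J : choiceType)
    (P : set I) (Q : set J) (e : I -> J -> F) (N : nat) :
  (0 < N)%N -> finite_set Q -> separated P Q e ->
  (forall i j, P i -> Q j -> e i j ^+ N = 1) -> finite_set P.
Proof.
move=> N0 /finite_seqP[s Qs] sep eN.
have [rs rsE] := closed_field_poly_normal ('X^N - 1%:P : {poly F}).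
have eP i j : P i -> j \in s -> e i j \in rs.
  move=> Pi js; have : root ('X^N - 1%:P : {poly F}) (e i j).
    by rewrite /root !hornerE eN ?subrr// Qs.
  rewrite rsE lead_coefXnsubC// scale1r.
  by rewrite root_prod_XsubC.
(* i is coded by the table of positions of its values in the list rs of roots;
   the extra position size rs is that of an absent value. *)
pose code i : {ffun 'I_(size s) -> 'I_(size rs).+1} :=
  [ffun k : 'I_(size s) => inord (index (nth 0 [seq e i j | j <- s] k) rs)].
suff codeI : {in P &, injective code}.
  by rewrite -(eq_finite_set (inj_card_eq codeI)).
move=> i i' /set_mem Pi /set_mem Pi' /ffunP eqc.
apply: sep => // j; rewrite Qs /= => js.
have := js; rewrite -index_mem => ks.
have := eqc (Ordinal ks); rewrite !ffunE /= !(nth_map j)// !nth_index//.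
move=> /(congr1 val); rewrite /= !inordK ?ltnS ?index_size//.
by apply: (index_inj 0); apply: eP.
Qed.

(** By [expr_card_eigenbij] all values of the pairing are roots of unity of order
    dividing the cardinal of Q. *)
Lemma finite_translation_closed (F : closedFieldType) (I J : choiceType)
    (P : set I) (Q : set J) (e : I -> J -> F) :
  translation_closed Q P (fun j i => e i j) -> separated P Q e ->
  (forall i j, P i -> Q j -> e i j != 0) ->
  finite_set Q -> finite_set P.
Proof.
move=> tQ sepP e0 finQ.
(* For empty Q the cardinal is not a legitimate exponent, but any other is. *)
have [Q0|/set0P[j0 Qj0]] := eqVneq Q set0.
  apply: (finite_family_roots_of_unity (N := 1) _ finQ sepP) => // i j _.
  by rewrite Q0.
apply: (finite_family_roots_of_unity (N := #|` fset_set Q|) _ finQ sepP).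
  rewrite cardfs_gt0; apply/fset0Pn; exists j0.
  by rewrite in_fset_set//; apply/mem_set.
move=> i j Pi Qj; have [h bijh hE] := tQ j Qj.
apply: (expr_card_eigenbij (f := e i) finQ bijh) => [j' Qj'|j' Qj'].
  exact: e0.
exact: hE.
Qed.

(** The preimage of i under the translation by i is a neutral element. *)
Lemma translation_closed_unit (F : fieldType) (I J : choiceType)
    (P : set I) (Q : set J) (e : I -> J -> F) (i : I) :
  translation_closed P Q e -> (forall i j, P i -> Q j -> e i j != 0) ->
  P i -> exists2 i0, P i0 & forall j, Q j -> e i0 j = 1.
Proof.
move=> tP e0 Pi; have [h [_ _ surjh] hE] := tP i Pi.
have [i0 Pi0 hi0] := surjh i Pi; exists i0 => // j Qj.
by apply: (mulfI (e0 i j Pi Qj)); rewrite -hE// hi0 mulr1.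
Qed.

(** Any i other than the neutral element i0 is separated from it by some j, so
    e i j is different from 1 and the translation by j kills the sum over Q;
    the row of i0 contributes 1 for each element of Q. *)
Lemma fsum_pairing (F : fieldType) (I J : choiceType)
    (P : set I) (Q : set J) (e : I -> J -> F) :
  translation_closed P Q e -> translation_closed Q P (fun j i => e i j) ->
  separated P Q e -> (forall i j, P i -> Q j -> e i j != 0) ->
  P !=set0 -> finite_set P -> finite_set Q ->
  \sum_(i \in P) \sum_(j \in Q) e i j = #|` fset_set Q|%:R.
Proof.
move=> tP tQ sepP e0 [i1 Pi1] finP finQ.
have [i0 Pi0 ei0] := translation_closed_unit tP e0 Pi1.
rewrite (fsbigD1 i0)//= [X in _ + X]fsbig1 ?addr0; last first.
  move=> i [Pi ii0].
  have [j Qj eij] : exists2 j, Q j & e i j != 1.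
    apply: contrapT => noj; apply: ii0; apply: sepP => // j Qj.
    rewrite ei0//; apply/eqP/negPn/negP => eij; apply: noj; by exists j.
  have [h bijh hE] := tQ j Qj.
  by apply: (fsum_eigenbij0 bijh eij) => j' Qj'; apply: hE.
rewrite (eq_fsbigr (fun=> 1)); last by move=> j /set_mem /ei0.
by rewrite fsbig_finite// big_const_seq count_predT iter_addr_0.
Qed.

(** Computing the double sum of e in both orders identifies the two cardinals,
    as natural numbers in F, hence in nat since F has characteristic 0. *)
Lemma counting_perfect_pairing (R : realType) (F : numClosedFieldType)
    (I J : choiceType) (P : set I) (Q : set J) (e : I -> J -> F) :
  translation_closed P Q e -> translation_closed Q P (fun j i => e i j) ->
  separated P Q e -> separated Q P (fun j i => e i j) ->
  (forall i j, P i -> Q j -> e i j != 0) ->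
  P !=set0 -> Q !=set0 -> counting P = counting Q :> \bar R.
Proof.
move=> tP tQ sepP sepQ e0 P0 Q0.
have e0' j i : Q j -> P i -> e i j != 0 by move=> Qj Pi; apply: e0.
rewrite /counting; case: asboolP => [finP|infP].
  have finQ : finite_set Q by apply: finite_translation_closed tP sepQ _ finP.
  rewrite asboolT//; congr (_%:R%:E); apply/eqP; rewrite -(@eqr_nat F).
  rewrite -(fsum_pairing tQ tP sepQ e0' Q0)// exchange_fsbig//.
  by rewrite (fsum_pairing tP tQ sepP e0 P0).
rewrite asboolF// => finQ; apply: infP.
exact: finite_translation_closed tQ sepP e0 finQ.
Qed.

(** * Extension of unitary characters *)

(** The graph of a unitary character defined on some subgroup of G. With graphs,
    extension is inclusion and the union of a chain is again a graph, which is
    the form required by the lemma of Zorn. Functionality follows from the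
    fibre over 0 being trivial. *)
Record partial_character (C : numClosedFieldType) (G : zmodType)
    (A : set (G * C)) : Prop := PartialCharacter {
  pchar0 : A (0, 1);
  pcharB : forall x y z w, A (x, z) -> A (y, w) -> A (x - y, z / w);
  pchar_norm : forall x z, A (x, z) -> `|z| = 1;
  pchar_inj : forall z, A (0, z) -> z = 1 }.

Lemma normr1_neq0 (C : numDomainType) (z : C) : `|z| = 1 -> z != 0.
Proof. by move=> z1; rewrite -normr_eq0 z1 oner_eq0. Qed.

Section PartialCharacter.
Variables (C : numClosedFieldType) (G : zmodType).
Implicit Types (A B : set (G * C)) (x y : G) (z w : C).

Lemma pcharN A x z : partial_character A -> A (x, z) -> A (- x, z^-1).
Proof.
by move=> pA Axz; have := pcharB pA (pchar0 pA) Axz; rewrite sub0r mul1r.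
Qed.

Lemma pcharD A x y z w : partial_character A ->
  A (x, z) -> A (y, w) -> A (x + y, z * w).
Proof.
move=> pA Axz /(pcharN pA) Ayw.
by have := pcharB pA Axz Ayw; rewrite opprK invrK.
Qed.

Lemma pcharMn A x z (n : nat) : partial_character A ->
  A (x, z) -> A (x *+ n, z ^+ n).
Proof.
move=> pA Axz; elim: n => [|n IHn]; first exact: pchar0.
by rewrite mulrS exprS; apply: pcharD.
Qed.

Lemma pcharMz A x z (n : int) : partial_character A ->
  A (x, z) -> A (x *~ n, z ^ n).
Proof.
move=> pA Axz; case: n => n; first exact: pcharMn.
exact: pcharN pA (pcharMn n.+1 pA Axz).
Qed.

Lemma pchar_fun A x z w : partial_character A ->
  A (x, z) -> A (x, w) -> z = w.
Proof.
move=> pA Axz Axw; have := pcharB pA Axz Axw.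
rewrite subrr => /(pchar_inj pA) /(canRL (divfK _)) ->; first by rewrite mul1r.
exact/normr1_neq0/(pchar_norm pA Axw).
Qed.

(** The extension of A to the subgroup generated by its domain and y that sends
    y to z. *)
Definition adjoin A y z : set (G * C) :=
  [set p | exists a w (n : int), A (a, w) /\ p = (a + y *~ n, w * z ^ n)].

(** The only obstruction to sending y to z is that multiples of y may already
    lie in the domain of A. *)
Lemma adjoin_partial_character A y z : partial_character A -> `|z| = 1 ->
  (forall (n : int) w, A (y *~ n, w) -> w = z ^ n) ->
  partial_character (adjoin A y z).
Proof.
move=> pA z1 comp; have z0 := normr1_neq0 z1.
split.
- exists 0, 1, 0; split; first exact: pchar0.
  by rewrite mulr0z expr0z addr0 mulr1.
- move=> _ _ _ _ [a [w [n [Aaw [-> ->]]]]] [b [v [m [Abv [-> ->]]]]].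
  exists (a - b), (w / v), (n - m); split; first exact: pcharB.
  by rewrite opprD addrACA mulrzBr expfzDr// -invr_expz invfM mulrACA.
- move=> _ _ [a [w [n [Aaw [_ ->]]]]].
  rewrite normrM (pchar_norm pA Aaw) mul1r.
  by case: n => n; rewrite ?normfV normrX z1 expr1n ?invr1.
- move=> _ [a [w [n [Aaw [/esym/eqP + ->]]]]].
  rewrite addr_eq0 => /eqP aE.
  have : A (y *~ n, w^-1) by have := pcharN pA Aaw; rewrite aE opprK.
  by move=> /comp <-; rewrite mulfV// (normr1_neq0 (pchar_norm pA Aaw)).
Qed.

Lemma sub_adjoin A y z : A `<=` adjoin A y z.
Proof.
move=> [a w] Aaw; exists a, w, 0; split=> //.
by rewrite mulr0z expr0z addr0 mulr1.
Qed.

Lemma adjoin_gen A y z : partial_character A -> adjoin A y z (y, z).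
Proof.
move=> pA; exists 0, 1, 1; split; first exact: pchar0.
by rewrite mulr1z expr1z add0r mul1r.
Qed.

End PartialCharacter.

(** An m-th root of w other than 1 exists: for w = 1 take a root of
    1 + 'X + ... + 'X^(m - 1), whose value at 1 is m, which is nonzero. *)
Lemma nontrivial_root (C : numClosedFieldType) (m : nat) (w : C) :
  (1 < m)%N -> exists2 z, z ^+ m = w & z != 1.
Proof.
move=> m1; have [->|w1] := eqVneq w 1; last first.
  exists (m.-root w); first by rewrite rootCK// ltnW.
  apply: contra w1 => /eqP z1.
  by rewrite -(rootCK (ltnW m1) w) z1 expr1n.
have [z rz] : exists z : C, root (\poly_(i < m) 1) z.
  apply/closed_rootP; rewrite size_poly_eq ?oner_eq0//.
  by apply/eqP => m1E; rewrite m1E in m1.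
have sz : \sum_(i < m) z ^+ i = 0.
  move/rootP: rz; rewrite horner_poly; apply: etrans.
  by apply: eq_bigr => i _; rewrite mul1r.
exists z.
  by apply/eqP; rewrite -subr_eq0 subrX1 sz mulr0.
apply/eqP => z1; move: sz; rewrite z1.
under eq_bigr do rewrite expr1n.
by rewrite sumr_const card_ord => /eqP; rewrite pnatr_eq0 -leqn0 leqNgt ltnW.
Qed.

(** If no positive multiple of y lies in the domain, y may be sent to any point
    of the circle, and -1 is chosen. Otherwise let m be the least positive
    integer with m y in the domain, where A takes the value v: all multiples of
    y in the domain are multiples of m y, so y may be sent to any m-th root of
    v, and m > 1 leaves a root different from 1. The value at y is kept away
    from 1 so that the same lemma provides the first step of a separating
    character. *)
Lemma partial_character_extension (C : numClosedFieldType) (G : zmodType)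
    (A : set (G * C)) (y : G) :
  partial_character A -> ~ (exists w, A (y, w)) ->
  exists B, [/\ partial_character B, A `<=` B & exists2 z, z != 1 & B (y, z)].
Proof.
move=> pA Ay.
suff [z [z1 zN1 comp]] : exists z : C, [/\ `|z| = 1, z != 1 &
    forall (n : int) w, A (y *~ n, w) -> w = z ^ n].
  exists (adjoin A y z); split; first exact: adjoin_partial_character.
    exact: sub_adjoin.
  by exists z => //; apply: adjoin_gen.
pose ord n := `[< (0 < n)%N /\ exists w, A (y *+ n, w) >].
have [exord|noord] := pselect (exists n, ord n); last first.
  exists (-1); split; first by rewrite normrN normr1.
    by rewrite eq_sym -addr_eq0 (_ : 1 + 1 = 2%:R)// pnatr_eq0.
  have nopos n w : A (y *+ n.+1, w) -> False.
    by move=> Anw; apply: noord; exists n.+1; apply/asboolP; split=> //; exists w.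
  case=> [[|n]|n] w; first by rewrite mulr0z expr0z => /(pchar_inj pA).
    by move=> /nopos.
  by rewrite NegzE mulrNz => /(pcharN pA); rewrite opprK => /nopos.
case: (ex_minnP exord) => m /asboolP[m0 [v Amv]] minm.
have m1 : (1 < m)%N.
  by case: m m0 Amv {minm} => [|[|m]]// _ Ayv; case: Ay; exists v.
have [z zm zN1] := nontrivial_root v m1.
have z1 : `|z| = 1.
  apply/eqP; rewrite -(@pexpr_eq1 _ _ m)//.
  by rewrite -normrX zm (pchar_norm pA Amv).
exists z; split=> // n w Anw.
have z0 := normr1_neq0 z1.
pose q := (n %/ m)%Z; pose r := `|(n %% m)%Z|%N.
have rE : (n %% m)%Z = r by rewrite /r gez0_abs// modz_ge0// -lt0n.
have nE : n = m%:Z * q + r by rewrite mulrC -rE -divz_eq.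
have Aqm : A (y *~ (m%:Z * q), z ^ (m%:Z * q)).
  rewrite mulrzA -exprz_exp; apply: pcharMz => //.
  by rewrite -zm in Amv.
have rm : (r < m)%N by rewrite -ltz_nat -rE ltz_pmod.
(* r y = n y - m q y lies in the domain, so r > 0 would contradict the
   minimality of m. *)
have r0 : r = 0%N.
  apply/eqP; rewrite -leqn0 leqNgt; apply/negP => r_gt0.
  suff /minm : ord r by rewrite leqNgt rm.
  apply/asboolP; split=> //; exists (w / z ^ (m%:Z * q)).
  have := pcharB pA Anw Aqm.
  by rewrite -mulrzBr {1}nE addrC addKr.
rewrite nE r0 addr0 in Anw *.
exact: (pchar_fun pA Anw Aqm).
Qed.

(** A maximal extension of A is total, as [partial_character_extension] would
    enlarge it otherwise. *)
Lemma total_partial_character (C : numClosedFieldType) (G : zmodType)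
    (A : set (G * C)) : partial_character A ->
  exists B, [/\ partial_character B, A `<=` B & forall x, exists z, B (x, z)].
Proof.
(* Zorn_bigcup also asks for the union of the empty chain, which cannot contain
   A; hence the property bears on A `|` B instead of B. *)
move=> pA; pose P (B : set (G * C)) := partial_character (A `|` B).
have [|M [PM maxM]] := @Zorn_bigcup _ P.
  move=> F FP totF.
  (* As F is a chain, two points of the union lie in a common graph, which is A
     or A `|` X for some X in F. *)
  have common p q : (A `|` \bigcup_(X in F) X) p ->
      (A `|` \bigcup_(X in F) X) q -> exists Y, [/\ partial_character Y,
      Y `<=` A `|` \bigcup_(X in F) X, Y p & Y q].
    have FY X : F X -> A `|` X `<=` A `|` \bigcup_(X in F) X.
      by move=> FX r [Ar|Xr]; [left|right; exists X].
    move=> [Ap|[X FX Xp]] [Aq|[Y FY' Yq]].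
    - by exists A; split=> //; left.
    - by exists (A `|` Y); split; [exact: FP|exact: FY|left|right].
    - by exists (A `|` X); split; [exact: FP|exact: FY|right|left].
    - have [XY|YX] := totF X Y FX FY'.
        by exists (A `|` Y); split;
          [exact: FP|exact: FY|right; exact: XY|right].
      by exists (A `|` X); split;
        [exact: FP|exact: FY|right|right; exact: YX].
  split.
  - by left; apply: pchar0.
  - move=> x y z w xz yw; have [Y [pY sY Yx Yy]] := common _ _ xz yw.
    by apply: sY; apply: pcharB.
  - move=> x z xz; have [Y [pY _ Yx _]] := common _ _ xz xz.
    exact: (pchar_norm pY Yx).
  - move=> z xz; have [Y [pY _ Yx _]] := common _ _ xz xz.
    exact: (pchar_inj pY Yx).
exists (A `|` M); split=> // x.
apply: contrapT => nx.
have [B [pB AMB [z _ Bxz]]] := partial_character_extension PM nx.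
have AB : A `|` B = B by apply/setUidr/(subset_trans _ AMB)/subsetUl.
apply: (maxM B); last by rewrite /P AB.
split; first by apply: subset_trans AMB; apply: subsetUr.
by move=> BM; apply: nx; exists z; right; apply: BM.
Qed.

(** Start from the trivial character of H, extend it to x with a value other
    than 1, and then to the whole of G. *)
Lemma separating_character (C : numClosedFieldType) (G : zmodType)
    (H : set G) (x : G) :
  H 0 -> (forall a b, H a -> H b -> H (a - b)) -> ~ H x ->
  exists rho : G -> C, [/\ (forall a b, rho (a + b) = rho a * rho b),
    (forall a, `|rho a| = 1), (forall a, H a -> rho a = 1) & rho x != 1].
Proof.
move=> H0 HB Hx; pose A : set (G * C) := [set p | H p.1 /\ p.2 = 1].
have pA : partial_character A.
  split=> //=.
  - by move=> a b z w [Ha /= ->] [Hb /= ->]; split; [exact: HB|rewrite divr1].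
  - by move=> a z [_ /= ->]; rewrite normr1.
  - by move=> z /= [].
have [|B [pB AB [z z1 Bxz]]] := @partial_character_extension C G A x pA.
  by move=> [w [/Hx]].
have [D [pD BD totD]] := total_partial_character pB.
have [rho rhoP] := choice totD.
exists rho; split=> [a b|a|a Ha|].
- exact: (pchar_fun pD (rhoP _) (pcharD pD (rhoP a) (rhoP b))).
- exact: (pchar_norm pD (rhoP a)).
- by apply: (pchar_fun pD (rhoP a)); apply/BD/AB.
- by rewrite (pchar_fun pD (rhoP x) (BD _ Bxz)).
Qed.

(** * Coincidence points and twisted conjugacy classes *)

Lemma set_bij_cancel (I : Type) (P : set I) (h k : I -> I) :
  (forall i, P i -> P (h i)) -> (forall i, P i -> P (k i)) ->
  cancel h k -> cancel k h -> set_bij P P h.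
Proof.
move=> Ph Pk hK kK; split=> //.
- by move=> i j _ _ /(can_inj hK).
- by move=> i Pi; exists (k i); [apply: Pk|rewrite kK].
Qed.

Section TwistedConjugacy.
Variables (R : realType) (G : zmodType) (phi psi : {additive G -> G}).
Local Notation C := R[i].
Local Notation cls := (twisted_class phi psi).

Lemma twisted_classP x y : cls x = cls y <-> twisted_conj phi psi x y.
Proof.
split=> [xy|xy].
  have : cls y y by apply: twisted_conj_refl.
  by rewrite -xy.
apply/seteqP; split=> z; rewrite /twisted_class /=.
  by apply: twisted_conj_trans; apply: twisted_conj_sym.
exact: twisted_conj_trans.
Qed.

Lemma twisted_conjDl x y z :
  twisted_conj phi psi y z -> twisted_conj phi psi (x + y) (x + z).
Proof. by move=> [g ->]; exists g; rewrite !addrA [x + _]addrC. Qed.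

Lemma twisted_conj0B x y : twisted_conj phi psi 0 x ->
  twisted_conj phi psi 0 y -> twisted_conj phi psi 0 (x - y).
Proof.
move=> [g ->] [h ->]; exists (g - h).
by rewrite (raddfB psi) (raddfB phi) !addr0 !opprB [phi h - _]addrC addrACA
  [- phi g + _]addrC.
Qed.

Lemma translate_twisted_class x y : [set x + z | z in cls y] = cls (x + y).
Proof.
apply/seteqP; split=> [_ [z yz <-]|z xyz]; first exact: twisted_conjDl.
exists (- x + z); last by rewrite addrA subrr add0r.
have : twisted_conj phi psi (- x + (x + y)) (- x + z) by apply: twisted_conjDl.
by rewrite addKr.
Qed.

(** A coincidence point takes the value rho (psi g) / rho (phi g) = 1 at
    psi g - phi g. *)
Lemma coincidence_point_class (rho : G -> C) x y :
  coincidence_points R phi psi rho -> twisted_conj phi psi x y ->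
  rho y = rho x.
Proof.
move=> [[rhoD rho1] rhoE] [g ->].
have rg : rho (phi g) = rho (psi g) by have := congr1 (@^~ g) rhoE.
apply: (mulIf (normr1_neq0 (rho1 (phi g)))).
by rewrite -rhoD subrK rhoD rg mulrC.
Qed.

(** The duality pairing between the annihilator of H and the quotient G / H: the
    choice of a point of A is immaterial for a coincidence point rho and a
    twisted class A. *)
Definition class_pairing (rho : G -> C) (A : set G) : C := rho (xget 0 A).

Lemma class_pairingE (rho : G -> C) x :
  coincidence_points R phi psi rho -> class_pairing rho (cls x) = rho x.
Proof.
move=> rhoP; apply: (coincidence_point_class rhoP).
by apply: (xgetI 0 (P := cls x)); apply: twisted_conj_refl.
Qed.

Lemma coincidence_points_translation :
  translation_closed (coincidence_points R phi psi)
    (twisted_classes phi psi) class_pairing.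
Proof.
move=> chi [[chiD chi1] chiE].
have chi0 x := normr1_neq0 (chi1 x).
exists (fun rho x => chi x * rho x) => //.
apply: (@set_bij_cancel _ _ _ (fun rho x => (chi x)^-1 * rho x)).
- move=> rho [[rhoD rho1] rhoE]; split; first split.
  + by move=> x y; rewrite chiD rhoD mulrACA.
  + by move=> x; rewrite normrM chi1 rho1 mulr1.
  + apply/funext => x; rewrite /dual_map /=; congr (_ * _).
      exact: (congr1 (@^~ x) chiE).
    exact: (congr1 (@^~ x) rhoE).
- move=> rho [[rhoD rho1] rhoE]; split; first split.
  + by move=> x y; rewrite chiD rhoD invfM mulrACA.
  + by move=> x; rewrite normrM normfV chi1 rho1 invr1 mulr1.
  + apply/funext => x; rewrite /dual_map /=; congr (_^-1 * _).
      exact: (congr1 (@^~ x) chiE).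
    exact: (congr1 (@^~ x) rhoE).
- by move=> rho; apply/funext => x; rewrite mulKf.
- by move=> rho; apply/funext => x; rewrite mulVKf.
Qed.

Lemma twisted_classes_translation :
  translation_closed (twisted_classes phi psi)
    (coincidence_points R phi psi) (fun A rho => class_pairing rho A).
Proof.
move=> _ [x _ <-]; exists (fun A => [set x + z | z in A]).
  have tK (a b : G) : a + b = 0 ->
      cancel (fun A : set G => [set a + z | z in A])
             (fun A => [set b + z | z in A]).
    move=> ab0 A; rewrite image_comp; apply/seteqP; split=> [_ [z Az <-]|z Az].
      by rewrite /= addrA [b + a]addrC ab0 add0r.
    by exists z; rewrite //= addrA [b + a]addrC ab0 add0r.
  apply: (@set_bij_cancel _ _ _ (fun A => [set - x + z | z in A])).
  - by move=> _ [y _ <-]; exists (x + y); rewrite ?translate_twisted_class.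
  - by move=> _ [y _ <-]; exists (- x + y); rewrite ?translate_twisted_class.
  - by apply: tK; rewrite subrr.
  - by apply: tK; rewrite addNr.
move=> _ rho [y _ <-] rhoP; rewrite translate_twisted_class.
by rewrite !class_pairingE//; case: rhoP => [[]].
Qed.

Lemma coincidence_points_separated :
  separated (coincidence_points R phi psi) (twisted_classes phi psi)
    class_pairing.
Proof.
move=> chi rho chiP rhoP eq_chi; apply/funext => x.
by rewrite -(class_pairingE x chiP) -(class_pairingE x rhoP) eq_chi//; exists x.
Qed.

(** If x and y are not twisted conjugate, y - x lies outside the class H of 0,
    and a character trivial on H detects it. *)
Lemma twisted_classes_separated :
  separated (twisted_classes phi psi) (coincidence_points R phi psi)
    (fun A rho => class_pairing rho A).
Proof.
move=> _ _ [x _ <-] [y _ <-] eq_xy; apply/twisted_classP; apply: contrapT => nxy.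
have nH : ~ twisted_conj phi psi 0 (y - x).
  by move=> /(twisted_conjDl x); rewrite addr0 addrC subrK.
have [rho [rhoD rho1 rhoH rho_yx]] :=
  @separating_character C G (cls 0) _ (twisted_conj_refl phi psi 0)
    twisted_conj0B nH.
have rhoP : coincidence_points R phi psi rho.
  split=> //; apply/funext => g; rewrite /dual_map /=.
  have rho_g : rho (psi g - phi g) = 1 by apply: rhoH; exists g; rewrite addr0.
  by rewrite -[psi g in RHS](subrK (phi g)) rhoD rho_g mul1r.
move: (eq_xy rho rhoP); rewrite !class_pairingE// => rho_xy.
case/eqP: rho_yx; apply: (mulIf (normr1_neq0 (rho1 x))).
by rewrite -rhoD subrK mul1r rho_xy.
Qed.

End TwistedConjugacy.

Theorem theorem1p3 (R : realType) (G : zmodType) (phi psi : {additive G -> G}) :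
  (reidemeister_number R phi psi < +oo)%E \/
    (coincidence_number R phi psi < +oo)%E ->
  reidemeister_number R phi psi = coincidence_number R phi psi.
Proof.
move=> _; apply: esym.
apply: (@counting_perfect_pairing _ _ _ _ _ _ (@class_pairing R G)).
- exact: coincidence_points_translation.
- exact: twisted_classes_translation.
- exact: coincidence_points_separated.
- exact: twisted_classes_separated.
- by move=> rho A [[_ rho1] _] _; exact: (normr1_neq0 (rho1 _)).
- by exists (fun=> 1); split=> //; split=> [x y|x]; rewrite ?mulr1 ?normr1.
- by exists (twisted_class phi psi 0); exists 0.
Qed.
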